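(* Let $(H;\langle\cdot,\cdot\rangle)$ be an inner product space over $\mathbb{K}$ ($\mathbb{K}=\mathbb{R}$ or $\mathbb{C}$) and let $x,y,e\in H$ with $\|e\|=1$. Suppose also that $a,A,b,B\in\mathbb{K}$ are such that $\operatorname{Re}(A\overline a)>0$ and $\operatorname{Re}(B\overline b)>0$. If either $$\operatorname{Re}\langle Ae-x,\,x-ae\rangle\ge0\quad\text{and}\quad\operatorname{Re}\langle Be-y,\,y-be\rangle\ge0,$$ or, equivalently, $$\left\|x-\frac{a+A}{2}e\right\|\le\frac12|A-a|\quad\text{and}\quad\left\|y-\frac{b+B}{2}e\right\|\le\frac12|B-b|$$ holds, then $$|\langle x,y\rangle-\langle x,e\rangle\langle e,y\rangle|\le\frac14\cdot\frac{|A-a|\,|B-b|}{\sqrt{\operatorname{Re}(A\overline a)\operatorname{Re}(B\overline b)}}\,|\langle x,e\rangle\langle e,y\rangle| .$$ The constant $\frac14$ is best possible.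
   Context: The inner product is linear in its first argument and $\|z\|=\sqrt{\langle z,z\rangle}$. A constant is called best possible if no smaller constant makes the inequality valid for all inner product spaces over $\mathbb{K}$ and all data satisfying the hypotheses. *)

(* Defs.v *)
From HB Require Import structures.
From mathcomp Require Import all_boot all_order all_algebra.
From mathcomp Require Import reals.
From mathcomp Require Import complex.

Set Implicit Arguments.
Unset Strict Implicit.
Unset Printing Implicit Defensive.

Import Order.TTheory GRing.Theory Num.Theory.
Local Open Scope ring_scope.

Variant scalar_kind := RealScalars | ComplexScalars.

Definition scalar_field (R : realType) (k : scalar_kind) : numFieldType :=
  match k with
  | RealScalars => R
  | ComplexScalars => R[i]
  end.

Section InnerProduct.
Variables (R : realType) (k : scalar_kind).
Local Notation K := (scalar_field R k).

Definition conjK : K -> K :=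
  match k return scalar_field R k -> scalar_field R k with
  | RealScalars => fun z => z
  | ComplexScalars => fun z => z^*
  end.

Definition reK : K -> R :=
  match k return scalar_field R k -> R with
  | RealScalars => fun z => z
  | ComplexScalars => fun z => complex.Re z
  end.

(* The MathComp norm `|z| lives in K itself (as a nonnegative real element);
   reK brings it back to R. *)
Definition absK (z : K) : R := reK `|z|.

(* {dot H for conjK} is the library type of positive definite conjK-hermitian
   forms on H, linear in the first argument. *)
Variables (H : lmodType K) (ip : {dot H for conjK}).
Local Notation "<< u , v >>" := (ip u v).

(* << z, z >> is real, so that reK only changes its type from K to R. *)
Definition ipnorm (z : H) : R := Num.sqrt (reK << z, z >>).

Definition inner_condition (e x : H) (a A : K) : Prop :=
  0 <= reK << A *: e - x, x - a *: e >>.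

Definition ball_condition (e x : H) (a A : K) : Prop :=
  ipnorm (x - ((a + A) / 2) *: e) <= 2^-1 * absK (A - a).

Definition gruss_inequality (c : R) (x y e : H) (a A b B : K) : Prop :=
  absK (<< x, y >> - << x, e >> * << e, y >>)
    <= c * (absK (A - a) * absK (B - b)
            / Num.sqrt (reK (A * conjK a) * reK (B * conjK b)))
         * absK (<< x, e >> * << e, y >>).

End InnerProduct.

Definition valid_constant (R : realType) (k : scalar_kind) (c : R) : Prop :=
  forall (H : lmodType (scalar_field R k)) (ip : {dot H for @conjK R k})
    (x y e : H) (a A b B : scalar_field R k),
    ipnorm ip e = 1 ->
    0 < reK (A * conjK a) ->
    0 < reK (B * conjK b) ->
    (inner_condition ip e x a A /\ inner_condition ip e y b B) \/
    (ball_condition ip e x a A /\ ball_condition ip e y b B) ->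
    gruss_inequality ip c x y e a A b B.

(* Main.v *)
Require Import Defs.
From HB Require Import structures.
From mathcomp Require Import all_boot all_order all_algebra.
From mathcomp Require Import reals.
From mathcomp Require Import complex.
From mathcomp Require Import ring lra.

Set Implicit Arguments.
Unset Strict Implicit.
Unset Printing Implicit Defensive.

(** Write p = <x, e>, q = <y, e>. Removing from x and y their components along
    the unit vector e leaves the residuals x - p e and y - q e, whose inner
    product is exactly <x, y> - <x, e><e, y> ([dot_residual]). By
    Cauchy-Schwarz it remains to bound the two residuals.

    The condition on x says that x lies in the ball having the segment from
    a e to A e as a diameter: d - m and d + m have inner product of real part
    |d|^2 - |m|^2, which gives the equivalence of the two forms of the
    hypothesis ([inner_condition_ball]). This ball has centre c e, with
    c = (a + A) / 2, and radius r = |A - a| / 2, and Re (A a^* ) is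
    |c|^2 - r^2. Its positivity thus means that the ball misses the origin, so
    that x lies in a cone around the line spanned by e, of half-angle
    arcsin (r / |c|). The squared tangent of the angle between x and that line
    is therefore at most r^2 / (|c|^2 - r^2), that is,
      |x - p e|^2 <= (|A - a|^2 / (4 Re (A a^* ))) |p|^2
    ([residual_bound]). Multiplying by the same bound for y and taking square
    roots yields the constant 1/4.

    All these inequalities become equalities when x = y touches the boundary
    of the cone. With e, f orthonormal, x = 8 e + 6 f and (a, A) = (5, 20) is
    such a configuration with integer coordinates, available over both scalar
    fields ([valid_constant_ge]). *)

Import Order.TTheory GRing.Theory Num.Theory.
Local Open Scope ring_scope.

(** * Real part and modulus of the scalars *)

(** The lemmas of this section are the only place where the real and the
    complex case are separated. *)
Section Scalars.
Variables (R : realType) (k : scalar_kind).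
Local Notation K := (scalar_field R k).
Implicit Types z w : K.

Fact conjK_is_zmod_morphism : zmod_morphism (@conjK R k).
Proof. by rewrite /conjK; case: k => // z w; rewrite rmorphB. Qed.

Fact conjK_is_monoid_morphism : monoid_morphism (@conjK R k).
Proof.
by rewrite /conjK; case: k => //; split=> [|z w]; rewrite (rmorph1, rmorphM).
Qed.

HB.instance Definition _ :=
  GRing.isZmodMorphism.Build K K (@conjK R k) conjK_is_zmod_morphism.
HB.instance Definition _ :=
  GRing.isMonoidMorphism.Build K K (@conjK R k) conjK_is_monoid_morphism.

Fact reK_is_zmod_morphism : zmod_morphism (@reK R k).
Proof. by rewrite /reK; case: k => // z w; rewrite raddfB. Qed.

HB.instance Definition _ :=
  GRing.isZmodMorphism.Build K R (@reK R k) reK_is_zmod_morphism.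

Lemma conjKK : involutive (@conjK R k).
Proof. by rewrite /conjK; case: k => // z; rewrite conjCK. Qed.

Lemma mulK_conj z : z * conjK z = `|z| ^+ 2.
Proof.
move: z; rewrite /conjK; case: k => z; last by rewrite normCK.
by rewrite real_normK ?num_real.
Qed.

Lemma reK1 : reK (1 : K) = 1.
Proof. by rewrite /reK; case: k. Qed.

Lemma reK_nat n : reK (n%:R : K) = n%:R.
Proof. by rewrite raddfMn /= reK1. Qed.

Lemma reK_conj z : reK (conjK z) = reK z.
Proof. by move: z; rewrite /reK /conjK; case: k => // -[]. Qed.

Lemma reK_ge0 z : 0 <= z -> 0 <= reK z.
Proof. by move: z; rewrite /reK; case: k => // -[u v] /andP[]. Qed.

(** Nonnegative elements of K are real, hence so are the values <u, u> and
    the norms: this is how products of such elements descend to R. *)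
Lemma ge0_reKM z w : 0 <= z -> reK (z * w) = reK z * reK w.
Proof.
move: z w; rewrite /reK; case: k => // -[a b] [c d] /andP[/eqP/= -> _].
by rewrite mul0r subr0.
Qed.

Lemma ge0_reK_inj z w : 0 <= z -> 0 <= w -> reK z = reK w -> z = w.
Proof.
move: z w; rewrite /reK; case: k => //.
by move=> -[a b] [c d] /andP[/eqP/= -> _] /andP[/eqP/= -> _] ->.
Qed.

Lemma absK_ge0 z : 0 <= absK z.
Proof. exact: reK_ge0. Qed.

Lemma absKM z w : absK (z * w) = absK z * absK w.
Proof. by rewrite /absK normrM ge0_reKM. Qed.

Lemma absK_conj z : absK (conjK z) = absK z.
Proof.
congr reK; apply: (pexpIrn (n := 2)); rewrite ?nnegrE //.
by rewrite -!mulK_conj conjKK mulrC.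
Qed.

Lemma absK_sqr z : absK z ^+ 2 = reK (z * conjK z).
Proof. by rewrite mulK_conj expr2 ge0_reKM. Qed.

Lemma reK_le_absK z : reK z <= absK z.
Proof.
move: z; rewrite /absK /reK; case: k => z; first exact: ler_norm.
have := normc_ge_Re z; case: z => a b /andP[_]; apply: le_trans.
exact: ler_norm.
Qed.

Lemma reK_mul_conjC z w : reK (z * conjK w) = reK (w * conjK z).
Proof. by rewrite -reK_conj rmorphM /= conjKK mulrC. Qed.

Lemma absK_sqrD z w :
  absK (z + w) ^+ 2 = absK z ^+ 2 + absK w ^+ 2 + 2 * reK (z * conjK w).
Proof.
rewrite !absK_sqr rmorphD /= mulrDl !mulrDr !raddfD /= (reK_mul_conjC w).
by ring.
Qed.

Lemma absKN z : absK (- z) = absK z.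
Proof. by rewrite /absK normrN. Qed.

Lemma absK_nat n : absK (n%:R : K) = n%:R.
Proof. by rewrite /absK normr_nat reK_nat. Qed.

Lemma absK_half z : absK (z / 2) = absK z / 2.
Proof.
apply: (canRL (mulfK _)); rewrite ?pnatr_eq0 //.
by rewrite -[X in _ * X](absK_nat 2) -absKM divfK ?pnatr_eq0.
Qed.

End Scalars.

(** * Positive definite hermitian forms *)

(** A conjugation is any ring endomorphism theta with z * theta z = |z|^2;
    identity on the reals and complex conjugation are both covered. *)
Section DotTheory.
Variables (K : numFieldType) (theta : {rmorphism K -> K}).
Hypothesis mul_theta : forall z, z * theta z = `|z| ^+ 2.
Variables (H : lmodType K) (ip : {dot H for theta}).
Local Notation "<< u , v >>" := (ip u v).

Lemma dot_ge0 u : 0 <= << u, u >>.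
Proof.
by have [->|/neq0_dnorm_gt0/ltW//] := eqVneq u 0; rewrite linear0r.
Qed.

Lemma dotC u v : << u, v >> = theta << v, u >>.
Proof. by rewrite hermC mul1r. Qed.

(** For v != 0, let r be u minus its projection on v. Then <v, v> <r, r> is
    the difference of the two sides. *)
Lemma cauchy_schwarz u v : `|<< u, v >>| ^+ 2 <= << u, u >> * << v, v >>.
Proof.
have [->|/(neq0_dnorm_gt0 (s:=ip)) v_gt0] := eqVneq v 0.
  by rewrite !linear0r normr0 expr0n mulr0.
have v_neq0 : << v, v >> != 0 by rewrite gt_eqF.
set r := u - (<< u, v >> / << v, v >>) *: v.
rewrite -subr_ge0.
suff -> : << u, u >> * << v, v >> - `|<< u, v >>| ^+ 2 = << v, v >> * << r, r >>.
  by rewrite mulr_ge0 ?dot_ge0.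
rewrite /r linearBl !linearBr /= !linearZl_LR !linearZr_LR /=.
rewrite -mul_theta rmorphM fmorphV /= -(dotC v u) -(dotC v v).
by field.
Qed.

End DotTheory.

(** * Residuals along a unit vector *)

Section UnitVector.
Variables (R : realType) (k : scalar_kind).
Local Notation K := (scalar_field R k).
Variables (H : lmodType K) (ip : {dot H for @conjK R k}).
Local Notation "<< u , v >>" := (ip u v).
Implicit Types (u v x y e : H) (a A c : K).

Definition sqnorm u : R := reK << u, u >>.

Lemma sqnorm_ge0 u : 0 <= sqnorm u.
Proof. exact/reK_ge0/dot_ge0. Qed.

Lemma sqnormD u v : sqnorm (u + v) = sqnorm u + sqnorm v + 2 * reK << u, v >>.
Proof.
rewrite /sqnorm linearDl !linearDr /= !raddfD /= (dotC ip v u) reK_conj.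
by ring.
Qed.

Lemma sqnormZ a u : sqnorm (a *: u) = absK a ^+ 2 * sqnorm u.
Proof.
rewrite /sqnorm linearZl_LR linearZr_LR /= mulrA mulK_conj absK_sqr mulK_conj.
by rewrite ge0_reKM // exprn_ge0.
Qed.

Lemma reK_dotBD u v : reK << u - v, v + u >> = sqnorm u - sqnorm v.
Proof.
rewrite linearBl !linearDr /= !raddfB !raddfD /= (dotC ip v u) reK_conj.
by rewrite /sqnorm; ring.
Qed.

Lemma reK_cauchy_schwarz u v : absK << u, v >> ^+ 2 <= sqnorm u * sqnorm v.
Proof.
rewrite absK_sqr mulK_conj /sqnorm -ge0_reKM ?dot_ge0 // -subr_ge0 -raddfB.
by rewrite reK_ge0 // subr_ge0 cauchy_schwarz // => z; exact: mulK_conj.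
Qed.

Variable e : H.
Hypothesis e_unit : ipnorm ip e = 1.

Lemma dot_unit : << e, e >> = 1.
Proof.
apply: ge0_reK_inj; rewrite ?dot_ge0 ?ler01 // reK1.
by have := sqr_sqrtr (sqnorm_ge0 e); rewrite -/(ipnorm ip e) e_unit expr1n.
Qed.

Lemma sqnorm_unit : sqnorm e = 1.
Proof. by rewrite /sqnorm dot_unit reK1. Qed.

Lemma ball_conditionE x a A :
  ball_condition ip e x a A <->
  sqnorm (x - ((a + A) / 2) *: e) <= (absK (A - a) / 2) ^+ 2.
Proof.
rewrite /ball_condition /ipnorm -/(sqnorm _).
have -> : 2^-1 * absK (A - a) = Num.sqrt ((absK (A - a) / 2) ^+ 2).
  by rewrite sqrtr_sqr ger0_norm ?divr_ge0 ?absK_ge0 // mulrC.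
by rewrite ler_sqrt ?sqr_ge0.
Qed.

(** With m = x - c e measured from the centre and d the half-diameter, the two
    vectors of the inner condition are d - m and m + d. *)
Lemma inner_conditionE x a A :
  inner_condition ip e x a A <->
  sqnorm (x - ((a + A) / 2) *: e) <= (absK (A - a) / 2) ^+ 2.
Proof.
rewrite /inner_condition -absK_half.
set m := x - ((a + A) / 2) *: e; set d := ((A - a) / 2) *: e.
have -> : A *: e - x = d - m.
  rewrite /d /m opprB addrA -scalerDl; congr (_ *: e - x).
  by field.
have -> : x - a *: e = m + d.
  rewrite /d /m -addrA -!scaleNr -scalerDl; congr (x + _ *: e).
  by field.
by rewrite reK_dotBD sqnormZ sqnorm_unit mulr1 subr_ge0.
Qed.

Lemma inner_condition_ball x a A :
  inner_condition ip e x a A <-> ball_condition ip e x a A.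
Proof. by rewrite inner_conditionE ball_conditionE. Qed.

Lemma pythagoras x c :
  sqnorm (x - c *: e) = sqnorm (x - << x, e >> *: e) + absK (<< x, e >> - c) ^+ 2.
Proof.
have -> : x - c *: e = (x - << x, e >> *: e) + (<< x, e >> - c) *: e.
  by rewrite scalerBl addrA subrK.
have ortho : << x - << x, e >> *: e, e >> = 0.
  by rewrite linearBl linearZl_LR /= dot_unit mulr1 subrr.
rewrite sqnormD sqnormZ sqnorm_unit linearZr_LR /= ortho.
by rewrite mulr0 raddf0 mulr0 addr0 mulr1.
Qed.

(** The cone bound. With S the squared residual, P = |<x, e>| and C = |c|, the
    point of the line spanned by e closest to x is at distance at least
    |P - C| from c e, so S <= r^2 - (P - C)^2. As P varies, the ratio S / P^2
    is maximal where x is tangent to the ball, namely C (C - P) = r^2: the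
    difference of the two sides is at least (r^2 - C (C - P))^2. *)
Lemma residual_in_ball x c (r : R) :
  sqnorm (x - c *: e) <= r ^+ 2 -> r ^+ 2 <= absK c ^+ 2 ->
  (absK c ^+ 2 - r ^+ 2) * sqnorm (x - << x, e >> *: e)
    <= r ^+ 2 * absK << x, e >> ^+ 2.
Proof.
rewrite pythagoras absK_sqrD absKN rmorphN mulrN raddfN /=.
have := reK_le_absK (<< x, e >> * conjK c); rewrite absKM absK_conj.
set S := sqnorm _; set P := absK << _, _ >>; set C := absK c; set q := reK _.
move=> q_le S_le r_le.
have {S_le q_le} S_le : S <= r ^+ 2 - (P - C) ^+ 2 by rewrite sqrrB; lra.
apply: (le_trans (ler_wpM2l _ S_le)); first by rewrite subr_ge0.
rewrite -subr_ge0.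
have -> : r ^+ 2 * P ^+ 2 - (C ^+ 2 - r ^+ 2) * (r ^+ 2 - (P - C) ^+ 2)
          = (r ^+ 2 - C * (C - P)) ^+ 2 by ring.
exact: sqr_ge0.
Qed.

(** The polarization identity |A + a|^2 - |A - a|^2 = 4 Re (A a^* ) identifies
    Re (A a^* ) with |c|^2 - r^2 in the cone bound. *)
Lemma residual_bound x a A :
  0 < reK (A * conjK a) -> ball_condition ip e x a A ->
  reK (A * conjK a) * sqnorm (x - << x, e >> *: e)
    <= (absK (A - a) / 2) ^+ 2 * absK << x, e >> ^+ 2.
Proof.
move=> M_gt0 /ball_conditionE ball_x.
have M_E : reK (A * conjK a) = absK ((a + A) / 2) ^+ 2 - (absK (A - a) / 2) ^+ 2.
  rewrite absK_half !expr_div_n (addrC a A) !absK_sqrD.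
  rewrite absKN rmorphN mulrN raddfN /=.
  by field.
rewrite M_E; apply: residual_in_ball => //.
by rewrite -subr_ge0 -M_E ltW.
Qed.

Lemma dot_residual x y :
  << x - << x, e >> *: e, y - << y, e >> *: e >>
    = << x, y >> - << x, e >> * << e, y >>.
Proof.
rewrite linearBl !linearBr /= !linearZl_LR !linearZr_LR /= dot_unit -dotC.
by ring.
Qed.

Lemma gruss_inequality_of_balls x y a A b B :
    0 < reK (A * conjK a) -> 0 < reK (B * conjK b) ->
    ball_condition ip e x a A -> ball_condition ip e y b B ->
  gruss_inequality ip 4^-1 x y e a A b B.
Proof.
move=> M_gt0 N_gt0 /(residual_bound M_gt0) hx /(residual_bound N_gt0) hy.
rewrite /gruss_inequality -dot_residual absKM (dotC ip e y) absK_conj.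
have := reK_cauchy_schwarz (x - << x, e >> *: e) (y - << y, e >> *: e).
move: hx hy M_gt0 N_gt0.
have := sqnorm_ge0 (x - << x, e >> *: e); have := sqnorm_ge0 (y - << y, e >> *: e).
have := absK_ge0 (A - a); have := absK_ge0 (B - b).
have := absK_ge0 << x, e >>; have := absK_ge0 << y, e >>.
have := absK_ge0 << x - << x, e >> *: e, y - << y, e >> *: e >>.
move: (absK << x - _, _ >>) (sqnorm (x - _)) (sqnorm (y - _)) => D S T.
move: (absK << x, e >>) (absK << y, e >>) => P Q.
move: (reK (A * conjK a)) (reK (B * conjK b)) (absK (A - a)) (absK (B - b)).
move=> M N r s D0 Q0 P0 s0 r0 T0 S0 hS hT M0 N0 hD.
have MN0 : 0 < M * N by exact: mulr_gt0.
have q0 : 0 < Num.sqrt (M * N) by rewrite sqrtr_gt0.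
have -> : 4^-1 * (r * s / Num.sqrt (M * N)) * (P * Q)
          = (r / 2 * P) * (s / 2 * Q) / Num.sqrt (M * N).
  by field; rewrite gt_eqF.
rewrite ler_pdivlMr // -(ler_pXn2r (n := 2)) // ?nnegrE; first last.
- by rewrite !mulr_ge0 ?invr_ge0.
- by rewrite mulr_ge0 // ltW.
rewrite exprMn sqr_sqrtr; last exact: ltW.
apply: (le_trans (ler_wpM2r (ltW MN0) hD)).
rewrite [leLHS](_ : _ = (M * S) * (N * T)); last by ring.
rewrite [leRHS]exprMn ler_pM // ?[leRHS]exprMn //.
- exact: mulr_ge0 (ltW M0) S0.
- exact: mulr_ge0 (ltW N0) T0.
Qed.

End UnitVector.

(** * Sharpness of the constant *)

Section Sharpness.
Variables (R : realType) (k : scalar_kind).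
Local Notation K := (scalar_field R k).

Definition stdform n (u v : 'rV[K]_n) : K := \sum_i u 0 i * conjK (v 0 i).

Fact stdform_is_bilinear n :
  bilinear_for (GRing.Scale.Law.clone _ _ *%R _)
    (GRing.Scale.Law.clone _ _ (@conjK R k \; *%R) _) (@stdform n).
Proof.
split=> u a v w /=; rewrite /stdform mulr_sumr -big_split /=;
  apply: eq_bigr => i _; rewrite !mxE.
  by rewrite mulrDl mulrA.
by rewrite rmorphD rmorphM /= mulrDr mulrCA.
Qed.

HB.instance Definition _ n := bilinear_isBilinear.Build K _ _ _ _ _
  (@stdform n) (@stdform_is_bilinear n).

Fact stdform_is_hermitian n (u v : 'rV[K]_n) :
  stdform u v = (-1) ^+ false * conjK (stdform v u).
Proof.
rewrite mul1r /stdform rmorph_sum; apply: eq_bigr => i _.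
by rewrite rmorphM /= conjKK mulrC.
Qed.

HB.instance Definition _ n := isHermitianSesquilinear.Build K _ _ _
  (@stdform n) (@stdform_is_hermitian n).

Fact stdform_gt0 n (u : 'rV[K]_n) : u != 0 -> 0 < stdform u u.
Proof.
move=> /rV0Pn[i u_i]; rewrite /stdform (bigD1 i) //= mulK_conj.
rewrite ltr_pwDl ?exprn_gt0 ?normr_gt0 //.
by apply: sumr_ge0 => j _; rewrite mulK_conj exprn_ge0.
Qed.

HB.instance Definition _ n := isDotProduct.Build K _
  (@stdform n) (@stdform_gt0 n).

Lemma stdform_delta n (i j : 'I_n) :
  stdform (delta_mx 0 i) (delta_mx 0 j) = (i == j)%:R.
Proof.
rewrite /stdform (bigD1 i) //= big1 => [|l /negPf l_i]; rewrite !mxE eqxx.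
  by rewrite eqxx mul1r rmorph_nat addr0.
by rewrite l_i mul0r.
Qed.

(** Any space with an orthonormal pair e, f contains an extremal
    configuration. For 0 < a < A, equality in the cone bound occurs at
    <x, e> = 2 a A / (a + A); the values a = 5, A = 20 make this 8 and the
    length of the residual 6, so that c must satisfy 36 <= c * (9 / 4) * 64. *)
Lemma valid_constant_ge (H : lmodType K) (ip : {dot H for @conjK R k}) (e f : H)
    (c : R) :
    ip e e = 1 -> ip f f = 1 -> ip e f = 0 -> valid_constant k c -> 4^-1 <= c.
Proof.
move=> ee ff ef valid_c.
have fe : ip f e = 0 by rewrite dotC ef rmorph0.
set x := 8 *: e + 6 *: f.
have norm_e : ipnorm ip e = 1 by rewrite /ipnorm ee reK1 sqrtr1.
have ipE (p q p' q' : K) : ip (p *: e + q *: f) (p' *: e + q' *: f)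
    = p * conjK p' + q * conjK q'.
  rewrite linearDl !linearDr /= !linearZl_LR !linearZr_LR /= ee ff ef fe.
  by ring.
have M_E : (20 : K) * conjK 5 = 100%:R by rewrite rmorph_nat -natrM.
have M_gt0 : 0 < reK ((20 : K) * conjK 5) by rewrite M_E reK_nat.
have inner_x : inner_condition ip e x 5 20.
  rewrite /inner_condition.
  have -> : 20 *: e - x = 12 *: e + (- 6) *: f.
    rewrite /x opprD addrA -scalerBl scaleNr; congr (_ *: _ - _); ring.
  have -> : x - 5 *: e = 3 *: e + 6 *: f.
    rewrite /x addrAC -scalerBl; congr (_ *: _ + _); ring.
  rewrite ipE !rmorph_nat.
  have -> : (12 : K) * 3 + - 6 * 6 = 0 by ring.
  by rewrite raddf0.
have := valid_c H ip x x e 5 20 5 20 norm_e M_gt0 M_gt0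
  (or_introl (conj inner_x inner_x)).
have xe : ip x e = 8.
  by rewrite /x linearDl /= !linearZl_LR /= ee fe mulr1 mulr0 addr0.
have ex : ip e x = 8 by rewrite dotC xe rmorph_nat.
have xx : ip x x = 100 by rewrite ipE !rmorph_nat; ring.
rewrite /gruss_inequality xe ex xx M_E reK_nat.
have -> : (100 : K) - 8 * 8 = 36 by ring.
have -> : (20 : K) - 5 = 15 by ring.
rewrite absKM !absK_nat -expr2 sqrtr_sqr ger0_norm //.
lra.
Qed.

End Sharpness.

Theorem theorem4 (R : realType) (k : scalar_kind) :
  (forall (H : lmodType (scalar_field R k)) (ip : {dot H for @conjK R k})
     (x y e : H) (a A b B : scalar_field R k),
     ipnorm ip e = 1 ->
     0 < reK (A * conjK a) ->
     0 < reK (B * conjK b) ->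
     (inner_condition ip e x a A /\ inner_condition ip e y b B) <->
     (ball_condition ip e x a A /\ ball_condition ip e y b B)) /\
  valid_constant k (4^-1 : R) /\
  (forall c : R, c < 4^-1 -> ~ valid_constant k c).
Proof.
split=> [H ip x y e a A b B e_unit _ _|].
  by rewrite !inner_condition_ball.
split=> [H ip x y e a A b B e_unit M_gt0 N_gt0 conditions|c c_lt valid_c].
  suff [ball_x ball_y] : ball_condition ip e x a A /\ ball_condition ip e y b B.
    exact: gruss_inequality_of_balls.
  by case: conditions => // -[]; rewrite !inner_condition_ball.
have : 4^-1 <= c.
  apply: (valid_constant_ge (ip := @stdform R k 2) (e := delta_mx 0 0)
    (f := delta_mx 0 1)) => //; exact: stdform_delta.
by rewrite leNgt c_lt.
Qed.
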